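(* Each of the logics $\mathbf{DL}(\partial)$ and $\mathbf{DL}(\partial^* )$ can simulate each of the logics $\mathbf{DL}(\delta)$ and $\mathbf{DL}(\delta^* )$ with respect to addition of facts. Explicitly, for every $L_1 \in \{\mathbf{DL}(\delta),\mathbf{DL}(\delta^* )\}$ with principal tag $d_1$, for every $L_2 \in \{\mathbf{DL}(\partial),\mathbf{DL}(\partial^* )\}$ with principal tag $d_2$, and for every defeasible theory $D_1$, there is a defeasible theory $D_2$ with the following property. For every theory $A=(F_A,\emptyset,\emptyset)$ consisting only of facts that is modular with respect to $D_1$ and $D_2$, and for every literal $q \in \Sigma(D_1+A)$: - $D_1+A \vdash +d_1 q$ in $L_1$ iff $D_2+A \vdash +d_2 q$ in $L_2$, and - $D_1+A \vdash -d_1 q$ in $L_1$ iff $D_2+A \vdash -d_2 q$ in $L_2$.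
   Context: Defeasible theories. Literals come from a language closed under negation. For a literal $q$, its complement ${\sim}q$ is $\neg p$ if $q=p$ is a proposition, and $p$ if $q=\neg p$. A defeasible theory $D=(F,R,>)$ consists of: - a set $F$ of literals (the facts); - a finite set $R$ of rules, each with a distinct label; - an acyclic binary relation $>$ on labels (the superiority relation). Each rule $r$ has a finite set $A(r)$ of body literals and a head literal. A rule is one of: - strict, written $A(r)\rightarrow q$; - defeasible, written $A(r)\Rightarrow q$; - a defeater, written $A(r)\leadsto q$. Notation: $R_s$ is the set of strict rules, $R_{sd}$ the set of strict or defeasible rules, and $R[q]$, $R_s[q]$, $R_{sd}[q]$ are the corresponding sets of rules with head $q$. $\Sigma(D)$ and $\Lambda(D)$ are the literals and the labels occurring in $D$. Conclusions. Conclusions have the form $+d\,q$ or $-d\,q$ for a tag $d \in \{\Delta,\partial,\partial^*,\delta,\sigma,\delta^*,\sigma^*\}$. Given $D$, an operator $\mathcal T_D$ maps sets $E$ of conclusions to sets of conclusions. The conclusions of $D$ are $\bigcup_n \mathcal T_D\uparrow n$, where $\mathcal T_D\uparrow 0=\emptyset$ and $\mathcal T_D\uparrow(n+1)=\mathcal T_D(\mathcal T_D\uparrow n)$. We write $D\vdash\alpha$ when $\alpha$ is a conclusion of $D$. For a set $B$ of literals, ''$+d B\subseteq E$'' means $+d\,a\in E$ for all $a\in B$. The operator $\mathcal T_D$ is defined by the following clauses. $+\Delta q\in\mathcal T_D(E)$ iff $q\in F$, or there is $r\in R_s[q]$ with $+\Delta A(r)\subseteq E$. $-\Delta q\in\mathcal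 T_D(E)$ iff $q\notin F$ and every $r\in R_s[q]$ has some $a\in A(r)$ with $-\Delta a\in E$. $+\partial q\in \mathcal T_D(E)$ iff either $+\Delta q\in E$, or all of the following hold: - some $r\in R_{sd}[q]$ has $+\partial A(r)\subseteq E$; - $-\Delta{\sim}q\in E$; - every $s\in R[{\sim}q]$ either has some $a\in A(s)$ with $-\partial a\in E$, or there is $t\in R_{sd}[q]$ with $+\partial A(t)\subseteq E$ and $t>s$. $-\partial q\in\mathcal T_D(E)$ iff $-\Delta q\in E$ and one of the following holds: - every $r\in R_{sd}[q]$ has some $a\in A(r)$ with $-\partial a\in E$; - $+\Delta{\sim}q\in E$; - some $s\in R[{\sim}q]$ has $+\partial A(s)\subseteq E$ and every $t\in R_{sd}[q]$ either has some $a\in A(t)$ with $-\partial a\in E$ or satisfies not $t>s$. $+\partial^* q\in\mathcal T_D(E)$ iff either $+\Delta q\in E$, or there is $r\in R_{sd}[q]$ such that: - $+\partial^*A(r)\subseteq E$; - $-\Delta{\sim}q\in E$; - every $s\in R[{\sim}q]$ either has some $a\in A(s)$ with $-\partial^* a\in E$, or satisfies $r>s$. $-\partial^* q\in\mathcal T_D(E)$ iff $-\Delta q\in E$ and every $r\in R_{sd}[q]$ satisfies one of: - some $a\in A(r)$ has $-\partial^*a\in E$; - $+\Delta{\sim}q\in E$; - some $s\in R[{\sim}q]$ has $+\partial^*A(s)\subseteq E$ and not $r>s$. $\pm\delta$ are defined exactly as $\pm\partial$, with every $\partial$ replaced by $\delta$, with two exceptions. In the $+\delta$ clause, the escape for $s$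 is ''some $a\in A(s)$ has $-\sigma a\in E$''. In the $-\delta$ clause, the condition on $s$ is ''$+\sigma A(s)\subseteq E$''. $+\sigma q\in\mathcal T_D(E)$ iff either $+\Delta q\in E$, or there is $r\in R_{sd}[q]$ with $+\sigma A(r)\subseteq E$ such that every $s\in R[{\sim}q]$ either has some $a\in A(s)$ with $-\delta a\in E$ or satisfies not $s>r$. $-\sigma q\in\mathcal T_D(E)$ iff $-\Delta q\in E$ and every $r\in R_{sd}[q]$ either has some $a\in A(r)$ with $-\sigma a\in E$, or there is $s\in R[{\sim}q]$ with $+\delta A(s)\subseteq E$ and $s>r$. $\pm\delta^*$ are defined exactly as $\pm\partial^*$, with every $\partial^*$ replaced by $\delta^*$, with two exceptions. In the $+\delta^*$ clause, the escape for $s$ is ''some $a\in A(s)$ has $-\sigma^*a\in E$''. In the $-\delta^*$ clause, the condition on $s$ is ''$+\sigma^*A(s)\subseteq E$''. $\pm\sigma^*$ are defined exactly as $\pm\sigma$, with $\sigma,\delta$ replaced by $\sigma^*,\delta^*$ respectively. The logic $\mathbf{DL}(d)$, for $d\in\{\partial,\partial^*,\delta,\delta^*\}$, has principal tag $d$ and uses these inference rules. Addition. For theories $D=(F,R,>)$ and $A=(F',R',>')$ with $\Lambda(D)\cap\Lambda(A)=\emptyset$, define $D+A=(F\cup F',R\cup R',>\cup>')$. Given theories $D_1,D_2$, an addition $A$ is modular if - $\Sigma(A)\cap\Sigma(D_2)\subseteq\Sigma(D_1)$, - $\Lambda(D_1)\cap\Lambda(A)=\emptyset$, and - $\Lambda(D_2)\cap\Lambda(A)=\emptyset$.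 Simulation. Let $L_1$ and $L_2$ be logics with principal tags $d_1$ and $d_2$, and let $C$ be a class of theories. A theory $D_1$ in $L_1$ is simulated by $D_2$ in $L_2$ with respect to $C$ if, for every $A\in C$ modular with respect to $D_1,D_2$ and every literal $q\in\Sigma(D_1+A)$: - $D_1+A\vdash +d_1q$ iff $D_2+A\vdash+d_2q$, and - $D_1+A\vdash -d_1q$ iff $D_2+A\vdash-d_2q$. $L_1$ can be simulated by $L_2$ with respect to $C$ if every theory in $L_1$ is simulated by some theory in $L_2$. ''Addition of facts'' means $C$ is the class of theories $(F,\emptyset,\emptyset)$; ''addition of rules'' means $C$ is the class of theories $(\emptyset,R,\emptyset)$. *)

(* Defs.v *)
From Stdlib Require Import List Relations.
Import ListNotations.

(* Propositions (atoms) are natural numbers: an unbounded supply of atoms. *)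
Definition atom := nat.
Definition label := nat.

Inductive literal : Type := Pos (p : atom) | Neg (p : atom).

Definition compl (q : literal) : literal :=
  match q with Pos p => Neg p | Neg p => Pos p end.

Inductive rkind : Type := Strict | Defeasible | Defeater.

Record rule : Type := mkRule {
  lab  : label;
  body : list literal;   (* A(r), a finite set of literals *)
  head : literal;
  kind : rkind }.

Record theory : Type := mkTheory {
  facts : literal -> Prop;
  rules : list rule;                (* the finite set R *)
  sup   : label -> label -> Prop }.

Definition wf_theory (D : theory) : Prop :=
  NoDup (map lab (rules D)) /\
  (forall l : label, ~ clos_trans label (sup D) l l).

Definition is_strict (r : rule) : Prop := kind r = Strict.
Definition is_sd (r : rule) : Prop := kind r = Strict \/ kind r = Defeasible.

Definition Sigma (D : theory) (q : literal) : Prop :=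
  facts D q \/
  exists r, In r (rules D) /\ (head r = q \/ In q (body r)).

Definition Lambda (D : theory) (l : label) : Prop :=
  (exists r, In r (rules D) /\ lab r = l) \/
  (exists l', sup D l l' \/ sup D l' l).

Definition add_theory (D A : theory) : theory :=
  mkTheory (fun q => facts D q \/ facts A q)
           (rules D ++ rules A)
           (fun l l' => sup D l l' \/ sup A l l').

Definition modular (D1 D2 A : theory) : Prop :=
  (forall q, Sigma A q -> Sigma D2 q -> Sigma D1 q) /\
  (forall l, Lambda D1 l -> Lambda A l -> False) /\
  (forall l, Lambda D2 l -> Lambda A l -> False).

Definition facts_theory (F : literal -> Prop) : theory :=
  mkTheory F [] (fun _ _ => False).

Inductive sign : Type := Plus | Minus.
Inductive tag : Type :=
  | tDelta | tPartial | tPartialS | tdelta | tsigma | tdeltaS | tsigmaS.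

Record concl : Type := Concl { csign : sign; ctag : tag; clit : literal }.

Section Operator.
Variable D : theory.
Variable E : concl -> Prop.

Definition allE (s : sign) (t : tag) (B : list literal) : Prop :=
  forall a, In a B -> E (Concl s t a).
Definition someE (s : sign) (t : tag) (B : list literal) : Prop :=
  exists a, In a B /\ E (Concl s t a).

Definition supl (r s : rule) : Prop := sup D (lab r) (lab s).

Definition plusDelta (q : literal) : Prop :=
  facts D q \/
  exists r, In r (rules D) /\ is_strict r /\ head r = q /\ allE Plus tDelta (body r).

Definition minusDelta (q : literal) : Prop :=
  ~ facts D q /\
  forall r, In r (rules D) -> is_strict r -> head r = q -> someE Minus tDelta (body r).

(* +partial-like (d = partial, e = partial) and +delta (d = delta, e = sigma):
   e is the tag of the escape "-e a" for attacking rules. *)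
Definition plusAmb (d e : tag) (q : literal) : Prop :=
  E (Concl Plus tDelta q) \/
  ((exists r, In r (rules D) /\ is_sd r /\ head r = q /\ allE Plus d (body r)) /\
   E (Concl Minus tDelta (compl q)) /\
   (forall s, In s (rules D) -> head s = compl q ->
      someE Minus e (body s) \/
      exists t, In t (rules D) /\ is_sd t /\ head t = q /\
                allE Plus d (body t) /\ supl t s)).

(* -partial (d = e = partial) and -delta (d = delta, e = sigma):
   e is the tag of "+e A(s)" for attacking rules. *)
Definition minusAmb (d e : tag) (q : literal) : Prop :=
  E (Concl Minus tDelta q) /\
  ((forall r, In r (rules D) -> is_sd r -> head r = q -> someE Minus d (body r)) \/
   E (Concl Plus tDelta (compl q)) \/
   (exists s, In s (rules D) /\ head s = compl q /\ allE Plus e (body s) /\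
      forall t, In t (rules D) -> is_sd t -> head t = q ->
        someE Minus d (body t) \/ ~ supl t s)).

Definition plusAmbS (d e : tag) (q : literal) : Prop :=
  E (Concl Plus tDelta q) \/
  exists r, In r (rules D) /\ is_sd r /\ head r = q /\
    allE Plus d (body r) /\
    E (Concl Minus tDelta (compl q)) /\
    (forall s, In s (rules D) -> head s = compl q ->
       someE Minus e (body s) \/ supl r s).

Definition minusAmbS (d e : tag) (q : literal) : Prop :=
  E (Concl Minus tDelta q) /\
  forall r, In r (rules D) -> is_sd r -> head r = q ->
    someE Minus d (body r) \/
    E (Concl Plus tDelta (compl q)) \/
    (exists s, In s (rules D) /\ head s = compl q /\
       allE Plus e (body s) /\ ~ supl r s).

Definition plusSig (sg dl : tag) (q : literal) : Prop :=
  E (Concl Plus tDelta q) \/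
  exists r, In r (rules D) /\ is_sd r /\ head r = q /\ allE Plus sg (body r) /\
    forall s, In s (rules D) -> head s = compl q ->
      someE Minus dl (body s) \/ ~ supl s r.

Definition minusSig (sg dl : tag) (q : literal) : Prop :=
  E (Concl Minus tDelta q) /\
  forall r, In r (rules D) -> is_sd r -> head r = q ->
    someE Minus sg (body r) \/
    exists s, In s (rules D) /\ head s = compl q /\ allE Plus dl (body s) /\ supl s r.

Definition T_op (c : concl) : Prop :=
  match c with
  | Concl Plus tDelta q => plusDelta q
  | Concl Minus tDelta q => minusDelta q
  | Concl Plus tPartial q => plusAmb tPartial tPartial q
  | Concl Minus tPartial q => minusAmb tPartial tPartial q
  | Concl Plus tPartialS q => plusAmbS tPartialS tPartialS q
  | Concl Minus tPartialS q => minusAmbS tPartialS tPartialS q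
  | Concl Plus tdelta q => plusAmb tdelta tsigma q
  | Concl Minus tdelta q => minusAmb tdelta tsigma q
  | Concl Plus tdeltaS q => plusAmbS tdeltaS tsigmaS q
  | Concl Minus tdeltaS q => minusAmbS tdeltaS tsigmaS q
  | Concl Plus tsigma q => plusSig tsigma tdelta q
  | Concl Minus tsigma q => minusSig tsigma tdelta q
  | Concl Plus tsigmaS q => plusSig tsigmaS tdeltaS q
  | Concl Minus tsigmaS q => minusSig tsigmaS tdeltaS q
  end.
End Operator.

Fixpoint T_iter (D : theory) (n : nat) : concl -> Prop :=
  match n with
  | 0 => fun _ => False
  | S n' => T_op D (T_iter D n')
  end.

Definition derives (D : theory) (c : concl) : Prop :=
  exists n, T_iter D n c.

Definition simulated_facts (d1 : tag) (D1 : theory) (d2 : tag) (D2 : theory) : Prop :=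
  forall FA : literal -> Prop,
    let A := facts_theory FA in
    modular D1 D2 A ->
    forall q, Sigma (add_theory D1 A) q ->
      (derives (add_theory D1 A) (Concl Plus d1 q) <->
       derives (add_theory D2 A) (Concl Plus d2 q)) /\
      (derives (add_theory D1 A) (Concl Minus d1 q) <->
       derives (add_theory D2 A) (Concl Minus d2 q)).

(* Main.v *)
From Stdlib Require Import List Relations Arith Lia Classical ClassicalEpsilon.
From Stdlib Require Import FunctionalExtensionality PropExtensionality.
Require Import Defs.
Import ListNotations.

(** The simulating theory uses no new literals, which matters because the facts may exhaust the language. Three observations make this possible.

    First, the support status of a literal is a fixpoint over the finitely many body literals with the principal statuses as parameters, so unrolling it often enough turns the principal status of [q] into a Kleene formula P(q) in principal statuses alone. In the unrolling, "definite" may be replaced by "principally provable", because [+delta] implies [+sigma] and [-sigma] implies [-delta].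

    Second, a disjunctive normal form of P(q) can be evaluated by one step of ambiguity blocking: a clause becomes a defeasible rule for [q] with the positive literals of the clause as its body, and the negative literals are tested by defeaters which exactly the unaffected clauses override.

    Third, the rules so obtained for [q] and for its complement attack each other, and these attacks must not change the outcome. Each clause records the set (team) of original rules it comes from, and takes priority over a clause for the complement if its team beats every rule of the other team. Acyclicity is inherited from the given superiority relation. *)

(** * Classical selection from lists, maximal elements and finite growing chains *)

Definition decide (P : Prop) : bool :=
  if excluded_middle_informative P then true else false.

Definition select {A} (P : A -> Prop) (l : list A) : list A :=
  filter (fun x => decide (P x)) l.

Lemma decide_true (P : Prop) : decide P = true <-> P.
Proof.
  unfold decide; destruct (excluded_middle_informative P); split; easy.
Qed.

Lemma in_select {A} (P : A -> Prop) l x : In x (select P l) <-> In x l /\ P x.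
Proof. unfold select; rewrite filter_In, decide_true; tauto. Qed.

Fixpoint sublists {A} (l : list A) : list (list A) :=
  match l with
  | [] => [[]]
  | x :: l' => sublists l' ++ map (cons x) (sublists l')
  end.

Lemma sublists_incl {A} (l s : list A) : In s (sublists l) -> incl s l.
Proof.
  revert s; induction l as [|x l IH]; simpl; intros s Hs.
  - destruct Hs as [<-|[]]; apply incl_refl.
  - apply in_app_or in Hs; destruct Hs as [Hs|Hs].
    + apply incl_tl, IH, Hs.
    + apply in_map_iff in Hs; destruct Hs as [s' [<- Hs]].
      apply incl_cons; [now left | apply incl_tl, IH, Hs].
Qed.

Lemma filter_sublist {A} (f : A -> bool) l : In (filter f l) (sublists l).
Proof.
  induction l as [|x l IH]; simpl; [now left|].
  apply in_or_app; destruct (f x); [right | left]; auto using in_map.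
Qed.

Lemma nil_sublist {A} (l : list A) : In [] (sublists l).
Proof. induction l; simpl; [now left | apply in_or_app; now left]. Qed.

Lemma singleton_sublist {A} (l : list A) x : In x l -> In [x] (sublists l).
Proof.
  induction l as [|y l IH]; simpl; [easy|]; intros [<-|Hx]; apply in_or_app.
  - right; apply (in_map (cons y)), nil_sublist.
  - left; auto.
Qed.

Lemma exists_maximal {A} (gt : A -> A -> Prop) (l : list A) :
  (forall x y z, gt x y -> gt y z -> gt x z) -> (forall x, ~ gt x x) ->
  l <> [] -> exists m, In m l /\ forall x, In x l -> ~ gt x m.
Proof.
  intros Htr Hirr; induction l as [|x l IH]; [easy|]; intros _.
  destruct l as [|y l].
  - exists x; split; [now left|]; intros z [<-|[]]; apply Hirr.
  - destruct IH as [m [Hm Hmax]]; [easy|].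
    destruct (classic (gt x m)) as [Hxm|Hxm].
    + exists x; split; [now left|]; intros z [<-|Hz]; [apply Hirr|].
      intros Hzx; exact (Hmax z Hz (Htr _ _ _ Hzx Hxm)).
    + exists m; split; [now right|]; intros z [<-|Hz]; auto.
Qed.

Lemma select_length_le {A} (P Q : A -> Prop) l :
  (forall x, In x l -> P x -> Q x) -> length (select P l) <= length (select Q l).
Proof.
  induction l as [|y l IH]; simpl; intros HPQ; [lia|].
  specialize (IH (fun x Hx => HPQ x (or_intror Hx))); fold (select P l) (select Q l).
  specialize (HPQ y (or_introl eq_refl)).
  destruct (decide (P y)) eqn:HP; destruct (decide (Q y)) eqn:HQ; simpl; try lia.
  rewrite decide_true in HP; apply HPQ in HP; rewrite <- decide_true in HP; congruence.
Qed.

Lemma select_length_lt {A} (P Q : A -> Prop) l z :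
  (forall x, In x l -> P x -> Q x) -> In z l -> Q z -> ~ P z ->
  length (select P l) < length (select Q l).
Proof.
  induction l as [|y l IH]; simpl; intros HPQ Hz HQz HPz; [easy|].
  fold (select P l) (select Q l).
  pose proof (select_length_le P Q l (fun x Hx => HPQ x (or_intror Hx))) as Hle.
  destruct Hz as [->|Hz].
  - destruct (decide (P z)) eqn:HP; [rewrite decide_true in HP; easy|].
    rewrite <- decide_true in HQz; rewrite HQz; simpl; lia.
  - specialize (IH (fun x Hx => HPQ x (or_intror Hx)) Hz HQz HPz).
    specialize (HPQ y (or_introl eq_refl)).
    destruct (decide (P y)) eqn:HP; destruct (decide (Q y)) eqn:HQ; simpl; try lia.
    rewrite decide_true in HP; apply HPQ in HP; rewrite <- decide_true in HP; congruence.
Qed.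

(** Pigeonhole: a step that still grows on [l] adds an element of [l], and by the second hypothesis
    a step without growth is followed only by such steps. Growth therefore ends after at most
    [length l] steps. *)
Lemma chain_stabilizes {A} (X : nat -> A -> Prop) (l : list A) :
  (forall k x, In x l -> X k x -> X (S k) x) ->
  (forall k, (forall x, In x l -> X (S k) x -> X k x) ->
     forall x, In x l -> X (S (S k)) x -> X (S k) x) ->
  forall k, length l <= k -> forall x, In x l -> X (S k) x -> X k x.
Proof.
  intros Hup Hst.
  assert (H : forall k, (forall x, In x l -> X (S k) x -> X k x) \/
                        S k <= length (select (X (S k)) l)).
  { assert (Hgrow : forall k, (forall x, In x l -> X (S k) x -> X k x) \/
                    length (select (X k) l) < length (select (X (S k)) l)).
    { intros k; destruct (classic (forall x, In x l -> X (S k) x -> X k x)) as [H|H];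
        [now left | right].
      apply not_all_ex_not in H; destruct H as [x H].
      apply imply_to_and in H; destruct H as [Hx H].
      apply imply_to_and in H; destruct H as [H1 H0].
      eapply select_length_lt; eauto. }
    induction k as [|k IH].
    - destruct (Hgrow 0) as [H|H]; [now left | right; lia].
    - destruct IH as [IH|IH]; [left; auto|].
      destruct (Hgrow (S k)) as [H|H]; [now left | right; lia]. }
  intros k Hk; destruct (H k) as [Hs|Hs]; [exact Hs|].
  assert (length (select (X (S k)) l) <= length l) by apply filter_length_le.
  lia.
Qed.

(** * Locality, monotonicity, continuity and coherence of the operator *)

Lemma compl_compl q : compl (compl q) = q.
Proof. now destruct q. Qed.

Definition relevant (D : theory) (q a : literal) : Prop :=
  a = q \/ a = compl q \/ exists r, In r (rules D) /\ In a (body r).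

(** All occurrences of [E] in the clauses are positive and concern relevant literals only. This
    yields both monotonicity of the stages and, the relevant literals being finite in number,
    continuity. *)
Lemma T_op_local D (E E' : concl -> Prop) s t q :
  (forall s' t' a, relevant D q a -> E (Concl s' t' a) -> E' (Concl s' t' a)) ->
  T_op D E (Concl s t q) -> T_op D E' (Concl s t q).
Proof.
  intros HE.
  assert (Hq : forall s' t', E (Concl s' t' q) -> E' (Concl s' t' q))
    by (intros; apply HE; [now left | assumption]).
  assert (Hc : forall s' t', E (Concl s' t' (compl q)) -> E' (Concl s' t' (compl q)))
    by (intros; apply HE; [right; now left | assumption]).
  assert (Ha : forall s' t' r, In r (rules D) ->
                 allE E s' t' (body r) -> allE E' s' t' (body r))
    by (intros s' t' r Hr H a Ha; apply HE; [right; right; eauto | auto]).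
  assert (Hs : forall s' t' r, In r (rules D) ->
                 someE E s' t' (body r) -> someE E' s' t' (body r))
    by (intros s' t' r Hr [a [Ha' H]]; exists a; split; [|apply HE; [right; right|]]; eauto).
  assert (Amb : forall d e, plusAmb D E d e q -> plusAmb D E' d e q).
  { intros d e [H|[[r (Hr & Hsd & Hh & H)] [Hd Hatt]]]; [left; auto | right].
    split; [exists r; auto | split; [auto|]].
    intros s' Hs' Hh'; destruct (Hatt s' Hs' Hh') as [H'|[t' (Ht & H1 & H2 & H3 & H4)]];
      [left; auto | right; exists t'; auto 6]. }
  assert (MAmb : forall d e, minusAmb D E d e q -> minusAmb D E' d e q).
  { intros d e [Hd [H|[H|[s' (H1 & H2 & H3 & H)]]]]; (split; [auto|]).
    - left; auto.
    - right; left; auto.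
    - right; right; exists s'; do 3 (split; [auto|]).
      intros t' Ht Hsd Hh; destruct (H t' Ht Hsd Hh); auto. }
  assert (AmbS : forall d e, plusAmbS D E d e q -> plusAmbS D E' d e q).
  { intros d e [H|[r (Hr & Hsd & Hh & H & Hd & Hatt)]]; [left; auto | right].
    exists r; do 5 (split; [auto|]).
    intros s' Hs' Hh'; destruct (Hatt s' Hs' Hh'); auto. }
  assert (MAmbS : forall d e, minusAmbS D E d e q -> minusAmbS D E' d e q).
  { intros d e [Hd H]; split; [auto|].
    intros r Hr Hsd Hh; destruct (H r Hr Hsd Hh) as [H'|[H'|[s' (H1 & H2 & H3 & H4)]]];
      [left | right; left | right; right; exists s']; auto. }
  assert (Sig : forall d e, plusSig D E d e q -> plusSig D E' d e q).
  { intros d e [H|[r (Hr & Hsd & Hh & H & Hatt)]]; [left; auto | right].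
    exists r; do 4 (split; [auto|]).
    intros s' Hs' Hh'; destruct (Hatt s' Hs' Hh'); auto. }
  assert (MSig : forall d e, minusSig D E d e q -> minusSig D E' d e q).
  { intros d e [Hd H]; split; [auto|].
    intros r Hr Hsd Hh; destruct (H r Hr Hsd Hh) as [H'|[s' (H1 & H2 & H3 & H4)]];
      [left | right; exists s']; auto. }
  destruct s, t; simpl; auto.
  - intros [H|[r (H1 & H2 & H3 & H4)]]; [now left | right; exists r; auto].
  - intros [H1 H2]; split; auto.
Qed.

Lemma T_iter_mono D n m c : n <= m -> T_iter D n c -> T_iter D m c.
Proof.
  assert (H : forall n c, T_iter D n c -> T_iter D (S n) c).
  { clear; induction n as [|n IH]; [easy|].
    intros [s t q]; change (T_op D (T_iter D n) (Concl s t q) ->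
                            T_op D (T_iter D (S n)) (Concl s t q)).
    apply T_op_local; auto. }
  induction 1; auto.
Qed.

Lemma derives_uniform D (l : list concl) :
  exists n, forall c, In c l -> derives D c -> T_iter D n c.
Proof.
  induction l as [|c l [n IH]]; [now exists 0|].
  destruct (classic (derives D c)) as [[m Hm]|Hc].
  - exists (n + m); intros c' [<-|Hc'] Hd.
    + apply (T_iter_mono D m); [lia | assumption].
    + apply (T_iter_mono D n); [lia | auto].
  - exists n; intros c' [<-|Hc'] Hd; [easy | auto].
Qed.

(* Finitely many conclusions are relevant to one application of the operator, which makes it continuous. *)
Lemma derives_closed D c : T_op D (derives D) c -> derives D c.
Proof.
  destruct c as [s t q]; intros H.
  set (lits := q :: compl q :: flat_map body (rules D)).
  set (tags := [tDelta; tPartial; tPartialS; tdelta; tsigma; tdeltaS; tsigmaS]).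
  destruct (derives_uniform D
    (flat_map (fun a => flat_map (fun t => [Concl Plus t a; Concl Minus t a]) tags) lits))
    as [n Hn].
  exists (S n); simpl; revert H; apply T_op_local; intros s' t' a Ha; apply Hn.
  apply in_flat_map; exists a; split.
  - destruct Ha as [->|[->|[r [Hr Ha]]]]; [now left | right; now left | right; right].
    apply in_flat_map; eauto.
  - apply in_flat_map; exists t'; split; [destruct t'; simpl; tauto|].
    destruct s'; simpl; auto.
Qed.

Lemma derives_open D c : derives D c -> T_op D (derives D) c.
Proof.
  intros [[|n] Hn]; [easy|]; destruct c as [s t q]; simpl in Hn; revert Hn.
  apply T_op_local; intros; now exists n.
Qed.

Lemma all_some_False (E : concl -> Prop) t l :
  (forall a, E (Concl Plus t a) -> E (Concl Minus t a) -> False) ->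
  allE E Plus t l -> someE E Minus t l -> False.
Proof. intros HE H [a [Ha H']]; eauto. Qed.

(** Each minus clause is the strong negation of its plus clause, so if both hold they clash on a
    fact, on a priority, or on opposite conclusions one stage earlier. All tags share one induction
    because principal and support tags refer to each other. *)
Lemma T_iter_coherent D n :
  forall t q, T_iter D n (Concl Plus t q) -> T_iter D n (Concl Minus t q) -> False.
Proof.
  induction n as [|n IH]; [easy|].
  pose proof (fun t l => all_some_False (T_iter D n) t l (IH t)) as AS.
  assert (Amb : forall d e q, plusAmb D (T_iter D n) d e q ->
            minusAmb D (T_iter D n) d e q -> False).
  { intros d e q [H|[[r (Hr & Hsd & Hh & H)] [Hd Hatt]]] [H' Hm]; [eauto|].
    destruct Hm as [Hm|[Hm|[s (H1 & H2 & H3 & Hm)]]]; [eauto..|].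
    destruct (Hatt s H1 H2) as [Hs|[t (T1 & T2 & T3 & T4 & T5)]]; [eauto|].
    destruct (Hm t T1 T2 T3); eauto. }
  assert (AmbS : forall d e q, plusAmbS D (T_iter D n) d e q ->
            minusAmbS D (T_iter D n) d e q -> False).
  { intros d e q [H|[r (Hr & Hsd & Hh & H & Hd & Hatt)]] [H' Hm]; [eauto|].
    destruct (Hm r Hr Hsd Hh) as [Hr'|[Hr'|[s (H1 & H2 & H3 & H4)]]]; [eauto..|].
    destruct (Hatt s H1 H2); eauto. }
  assert (Sig : forall d e q, plusSig D (T_iter D n) d e q ->
            minusSig D (T_iter D n) d e q -> False).
  { intros d e q [H|[r (Hr & Hsd & Hh & H & Hatt)]] [H' Hm]; [eauto|].
    destruct (Hm r Hr Hsd Hh) as [Hr'|[s (H1 & H2 & H3 & H4)]]; [eauto|].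
    destruct (Hatt s H1 H2); eauto. }
  intros t q; destruct t; simpl; eauto.
  intros [H|[r (H1 & H2 & H3 & H4)]] [H' Hm]; [auto|]; eauto.
Qed.

Lemma derives_coherent D t q :
  derives D (Concl Plus t q) -> derives D (Concl Minus t q) -> False.
Proof.
  intros [n Hn] [m Hm]; apply (T_iter_coherent D (n + m) t q).
  - apply (T_iter_mono D n); [lia | assumption].
  - apply (T_iter_mono D m); [lia | assumption].
Qed.

(** * Kleene formulas and their disjunctive normal forms *)

Inductive form : Type :=
  | FFalse
  | FLit (a : literal)
  | FNot (f : form)
  | FOr (f g : form).

Definition opp (s : sign) : sign :=
  match s with Plus => Minus | Minus => Plus end.

(* [ev V Plus f] and [ev V Minus f] say that [f] is true, resp. false, in strong Kleene logic when the literal [a] is true, resp. false, iff [V Plus a], resp. [V Minus a]; neither need hold. *)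
Fixpoint ev (V : sign -> literal -> Prop) (s : sign) (f : form) : Prop :=
  match f with
  | FFalse => s = Minus
  | FLit a => V s a
  | FNot f => ev V (opp s) f
  | FOr f g =>
      match s with
      | Plus => ev V Plus f \/ ev V Plus g
      | Minus => ev V Minus f /\ ev V Minus g
      end
  end.

(** Conjunctions and quantifiers are derived by de Morgan, which leaves [ev] and [dnf] only negation
    and disjunction to treat. *)
Definition FAnd (f g : form) : form := FNot (FOr (FNot f) (FNot g)).

Definition FEx {A} (l : list A) (g : A -> form) : form :=
  fold_right (fun x f => FOr (g x) f) FFalse l.

Definition FAll {A} (l : list A) (g : A -> form) : form :=
  FNot (FEx l (fun x => FNot (g x))).

Lemma ev_ex_plus {A} V (l : list A) g :
  ev V Plus (FEx l g) <-> exists x, In x l /\ ev V Plus (g x).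
Proof.
  induction l as [|x l IH]; simpl.
  - split; [discriminate | intros [x [[] _]]].
  - rewrite IH; split.
    + intros [H|[y [Hy H]]]; eauto.
    + intros [y [[<-|Hy] H]]; eauto.
Qed.

Lemma ev_ex_minus {A} V (l : list A) g :
  ev V Minus (FEx l g) <-> forall x, In x l -> ev V Minus (g x).
Proof.
  induction l as [|x l IH]; simpl; [easy|].
  rewrite IH; split; [intros [H1 H2] y [<-|Hy]; auto | auto].
Qed.

Lemma ev_all_plus {A} V (l : list A) g :
  ev V Plus (FAll l g) <-> forall x, In x l -> ev V Plus (g x).
Proof. apply (ev_ex_minus V l (fun x => FNot (g x))). Qed.

Lemma ev_all_minus {A} V (l : list A) g :
  ev V Minus (FAll l g) <-> exists x, In x l /\ ev V Minus (g x).
Proof. apply (ev_ex_plus V l (fun x => FNot (g x))). Qed.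

(* [dnf Minus f] is a disjunctive normal form of the negation of [f]. *)
Fixpoint dnf (s : sign) (f : form) : list (list (sign * literal)) :=
  match f with
  | FFalse => match s with Plus => [] | Minus => [[]] end
  | FLit a => [[(s, a)]]
  | FNot f => dnf (opp s) f
  | FOr f g =>
      match s with
      | Plus => dnf Plus f ++ dnf Plus g
      | Minus => flat_map (fun c => map (app c) (dnf Minus g)) (dnf Minus f)
      end
  end.

Lemma dnf_true V f s :
  ev V s f <-> exists c, In c (dnf s f) /\ forall s' a, In (s', a) c -> V s' a.
Proof.
  revert s; induction f as [|a|f IH|f IHf g IHg]; intros s; simpl.
  - destruct s; simpl; split; try easy.
    + intros [c [[] _]].
    + intros _; exists []; split; [now left | easy].
  - split.
    + intros H; exists [(s, a)]; split; [now left|].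
      intros s' a' [Heq|[]]; injection Heq as <- <-; exact H.
    + intros [c [[<-|[]] H]]; apply H; now left.
  - apply IH.
  - destruct s.
    + rewrite IHf, IHg; split.
      * intros [[c [Hc H]]|[c [Hc H]]]; exists c; rewrite in_app_iff; auto.
      * intros [c [Hc H]]; apply in_app_or in Hc; destruct Hc; eauto.
    + rewrite IHf, IHg; split.
      * intros [[c [Hc H]] [c' [Hc' H']]]; exists (c ++ c'); split.
        -- apply in_flat_map; exists c; split; [assumption | now apply in_map].
        -- intros s' a Ha; apply in_app_or in Ha; destruct Ha; auto.
      * intros [d [Hd H]]; apply in_flat_map in Hd; destruct Hd as [c [Hc Hd]].
        apply in_map_iff in Hd; destruct Hd as [c' [<- Hc']].
        split; [exists c | exists c'];
          (split; [assumption | intros; apply H, in_or_app; auto]).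
Qed.

(** Falsity in Kleene logic is not failure of truth, so this does not follow from [dnf_true] and
    needs its own induction. *)
Lemma dnf_false V f s :
  ev V (opp s) f <->
  forall c, In c (dnf s f) -> exists s' a, In (s', a) c /\ V (opp s') a.
Proof.
  revert s; induction f as [|a|f IH|f IHf g IHg]; intros s; simpl.
  - destruct s; simpl; split; try easy.
    intros H; destruct (H [] (or_introl eq_refl)) as [s [a [[] _]]].
  - split.
    + intros H c [<-|[]]; exists s, a; split; [now left | exact H].
    + intros H; destruct (H _ (or_introl eq_refl)) as [s' [a' [[Heq|[]] H']]].
      injection Heq as <- <-; exact H'.
  - apply IH.
  - destruct s; simpl.
    + rewrite (IHf Plus), (IHg Plus); split.
      * intros [H1 H2] c Hc; apply in_app_or in Hc; destruct Hc; auto.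
      * intros H; split; intros c Hc; apply H, in_or_app; auto.
    + rewrite (IHf Minus), (IHg Minus); split.
      * intros H d Hd; apply in_flat_map in Hd; destruct Hd as [c [Hc Hd]].
        apply in_map_iff in Hd; destruct Hd as [c' [<- Hc']].
        destruct H as [H|H]; [destruct (H c Hc) as [s' [a [Ha H']]]
                             |destruct (H c' Hc') as [s' [a [Ha H']]]];
          exists s', a; rewrite in_app_iff; auto.
      (* If each disjunct had a clause without a falsified literal, the concatenation of the two
         clauses would have none either. *)
      * intros H; apply NNPP; intros Hn; apply not_or_and in Hn; destruct Hn as [H1 H2].
        apply not_all_ex_not in H1; destruct H1 as [c H1].
        apply imply_to_and in H1; destruct H1 as [Hc H1].
        apply H2; intros c' Hc'.
        destruct (H (c ++ c')) as [s' [a [Ha H']]].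
        -- apply in_flat_map; exists c; split; [assumption | now apply in_map].
        -- apply in_app_or in Ha; destruct Ha as [Ha|Ha]; [|eauto].
           exfalso; eauto.
Qed.

(** * A common form of team defeat and individual defeat *)

Definition sd_rules (R : list rule) (q : literal) : list rule :=
  select (fun r => is_sd r /\ head r = q) R.

Definition attackers (R : list rule) (q : literal) : list rule :=
  select (fun r => head r = compl q) R.

(* The sets of supporting rules that may jointly overcome the attackers: with team defeat all nonempty ones, with individual defeat the singletons. *)
Definition teams (team : bool) (R : list rule) (q : literal) : list (list rule) :=
  if team then select (fun tau => tau <> []) (sublists (sd_rules R q))
  else map (fun r => [r]) (sd_rules R q).

Lemma in_sd_rules R q r : In r (sd_rules R q) <-> In r R /\ is_sd r /\ head r = q.
Proof. exact (in_select _ R r). Qed.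

Lemma in_attackers R q r : In r (attackers R q) <-> In r R /\ head r = compl q.
Proof. exact (in_select _ R r). Qed.

Lemma team_sd team R q tau t : In tau (teams team R q) -> In t tau -> In t (sd_rules R q).
Proof.
  destruct team; simpl; intros H Ht.
  - apply in_select in H; destruct H as [H _]; exact (sublists_incl _ _ H t Ht).
  - apply in_map_iff in H; destruct H as [r [<- Hr]]; destruct Ht as [<-|[]]; exact Hr.
Qed.

Lemma team_nonempty team R q tau : In tau (teams team R q) -> tau <> [].
Proof.
  destruct team; simpl; intros H.
  - now apply in_select in H.
  - apply in_map_iff in H; now destruct H as [r [<- _]].
Qed.

Lemma singleton_team team R q r : In r (sd_rules R q) -> In [r] (teams team R q).
Proof.
  destruct team; simpl; intros H.
  - apply in_select; split; [now apply singleton_sublist | easy].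
  - now apply (in_map (fun r => [r])).
Qed.

Definition beats (gt : rule -> rule -> Prop) (tau : list rule) (s : rule) : Prop :=
  exists t, In t tau /\ gt t s.

Definition attack_tag (d : tag) : tag :=
  match d with tdelta => tsigma | tdeltaS => tsigmaS | _ => d end.

Definition team_defeat (d : tag) : bool :=
  match d with tPartial | tdelta => true | _ => false end.

Definition principal (d : tag) : Prop :=
  d = tPartial \/ d = tPartialS \/ d = tdelta \/ d = tdeltaS.

(** Team and individual defeat now differ only in the admissible teams, so everything later treats
    the principal tags uniformly. *)
Lemma T_op_plus D E d q : principal d ->
  T_op D E (Concl Plus d q) <->
  E (Concl Plus tDelta q) \/
  (E (Concl Minus tDelta (compl q)) /\
   exists tau, In tau (teams (team_defeat d) (rules D) q) /\
     (forall t, In t tau -> allE E Plus d (body t)) /\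
     (forall s, In s (attackers (rules D) q) ->
        beats (supl D) tau s \/ someE E Minus (attack_tag d) (body s))).
Proof.
  assert (Team : forall e, plusAmb D E d e q <->
    E (Concl Plus tDelta q) \/
    (E (Concl Minus tDelta (compl q)) /\
     exists tau, In tau (teams true (rules D) q) /\
       (forall t, In t tau -> allE E Plus d (body t)) /\
       (forall s, In s (attackers (rules D) q) ->
          beats (supl D) tau s \/ someE E Minus e (body s)))).
  { intros e; split.
    - intros [H|[[r (Hr & Hsd & Hh & H)] [Hd Hatt]]]; [now left | right; split; [assumption|]].
      (* The largest candidate: all applicable supporting rules, among which every answer to an
         attacker is found. *)
      set (tau := select (fun t => allE E Plus d (body t)) (sd_rules (rules D) q)).
      assert (Htau : forall t, In t tau <-> In t (sd_rules (rules D) q) /\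
                                            allE E Plus d (body t))
        by (intros t; exact (in_select _ _ t)).
      exists tau; split; [|split].
      + apply in_select; split; [apply filter_sublist|].
        intros Hn; assert (Hin : In r tau) by (apply Htau; rewrite in_sd_rules; auto).
        now rewrite Hn in Hin.
      + intros t Ht; now apply Htau.
      + intros s Hs; apply in_attackers in Hs; destruct Hs as [Hs Hhs].
        destruct (Hatt s Hs Hhs) as [H'|[t (T1 & T2 & T3 & T4 & T5)]]; [now right | left].
        exists t; split; [apply Htau; rewrite in_sd_rules|]; auto.
    - intros [H|[Hd [tau (Htau & Hall & Hatt)]]]; [now left | right].
      assert (Hsd' : forall t, In t tau -> In t (rules D) /\ is_sd t /\ head t = q)
        by (intros t Ht; now apply in_sd_rules, (team_sd true _ _ tau)).
      split; [|split; [assumption|]].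
      + destruct tau as [|r tau]; [now apply team_nonempty in Htau|].
        exists r; destruct (Hsd' r (or_introl eq_refl)) as (H1 & H2 & H3).
        do 3 (split; [assumption|]); apply Hall; now left.
      + intros s Hs Hhs; destruct (Hatt s) as [[t [Ht Hts]]|H];
          [now apply in_attackers | right | now left].
        exists t; destruct (Hsd' t Ht) as (H1 & H2 & H3); auto 6. }
  assert (Single : forall e, plusAmbS D E d e q <->
    E (Concl Plus tDelta q) \/
    (E (Concl Minus tDelta (compl q)) /\
     exists tau, In tau (teams false (rules D) q) /\
       (forall t, In t tau -> allE E Plus d (body t)) /\
       (forall s, In s (attackers (rules D) q) ->
          beats (supl D) tau s \/ someE E Minus e (body s)))).
  { intros e; split.
    - intros [H|[r (Hr & Hsd & Hh & H & Hd & Hatt)]]; [now left | right; split; [assumption|]].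
      exists [r]; split; [|split].
      + apply singleton_team, in_sd_rules; auto.
      + intros t [<-|[]]; exact H.
      + intros s Hs; apply in_attackers in Hs; destruct Hs as [Hs Hhs].
        destruct (Hatt s Hs Hhs) as [H'|H']; [now right | left].
        exists r; split; [now left | assumption].
    - intros [H|[Hd [tau (Htau & Hall & Hatt)]]]; [now left | right].
      apply in_map_iff in Htau; destruct Htau as [r [<- Hr]]; exists r.
      apply in_sd_rules in Hr; destruct Hr as (H1 & H2 & H3).
      do 3 (split; [assumption|]); split; [apply Hall; now left | split; [assumption|]].
      intros s Hs Hhs; destruct (Hatt s) as [[t [[<-|[]] Hts]]|H]; auto.
      now apply in_attackers. }
  intros [->|[->|[->| ->]]]; [apply Team | apply Single | apply Team | apply Single].
Qed.

Lemma T_op_minus D E d q : principal d ->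
  T_op D E (Concl Minus d q) <->
  E (Concl Minus tDelta q) /\
  (E (Concl Plus tDelta (compl q)) \/
   forall tau, In tau (teams (team_defeat d) (rules D) q) ->
     (exists t, In t tau /\ someE E Minus d (body t)) \/
     (exists s, In s (attackers (rules D) q) /\ ~ beats (supl D) tau s /\
        allE E Plus (attack_tag d) (body s))).
Proof.
  assert (Team : forall e, minusAmb D E d e q <->
    E (Concl Minus tDelta q) /\
    (E (Concl Plus tDelta (compl q)) \/
     forall tau, In tau (teams true (rules D) q) ->
       (exists t, In t tau /\ someE E Minus d (body t)) \/
       (exists s, In s (attackers (rules D) q) /\ ~ beats (supl D) tau s /\
          allE E Plus e (body s)))).
  { intros e; split.
    - intros [Hd H]; split; [assumption|].
      destruct H as [H|[H|[s (Hs & Hh & Hall & H)]]]; [right | now left | right].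
      + intros tau Htau; left.
        destruct tau as [|r tau]; [now apply team_nonempty in Htau|].
        exists r; split; [now left|].
        destruct (proj1 (in_sd_rules _ _ _) (team_sd _ _ _ _ r Htau (or_introl eq_refl)))
          as (H1 & H2 & H3); auto.
      + intros tau Htau.
        destruct (classic (beats (supl D) tau s)) as [[t [Ht Hts]]|Hn].
        * left; exists t; split; [assumption|].
          destruct (proj1 (in_sd_rules _ _ _) (team_sd _ _ _ _ t Htau Ht)) as (H1 & H2 & H3).
          destruct (H t H1 H2 H3); easy.
        * right; exists s; rewrite in_attackers; auto.
    - intros [Hd H]; split; [assumption|].
      destruct H as [H|H]; [right; now left|].
      (* The team hardest to refute consists of all rules without a refuted body literal. An
         attacker that it does not beat serves against all supporting rules at once. *)
      set (tau := select (fun t => ~ someE E Minus d (body t)) (sd_rules (rules D) q)).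
      assert (Htau : forall t, In t tau <-> In t (sd_rules (rules D) q) /\
                                            ~ someE E Minus d (body t))
        by (intros t; exact (in_select _ _ t)).
      destruct (classic (tau = [])) as [Hn|Hn].
      + left; intros r Hr Hsd Hh; apply NNPP; intros Hf.
        assert (Hin : In r tau) by (apply Htau; rewrite in_sd_rules; auto).
        now rewrite Hn in Hin.
      + right; right.
        destruct (H tau) as [[t [Ht Hf]]|[s (Hs & Hb & Hall)]].
        * apply in_select; split; [apply filter_sublist | assumption].
        * now apply Htau in Ht.
        * apply in_attackers in Hs; destruct Hs as [Hs Hh].
          exists s; do 3 (split; [assumption|]); intros t Ht Hsd Hht.
          destruct (classic (someE E Minus d (body t))) as [Hf|Hf]; [now left | right].
          intros Hts; apply Hb; exists t; split; [|assumption].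
          apply Htau; rewrite in_sd_rules; auto. }
  assert (Single : forall e, minusAmbS D E d e q <->
    E (Concl Minus tDelta q) /\
    (E (Concl Plus tDelta (compl q)) \/
     forall tau, In tau (teams false (rules D) q) ->
       (exists t, In t tau /\ someE E Minus d (body t)) \/
       (exists s, In s (attackers (rules D) q) /\ ~ beats (supl D) tau s /\
          allE E Plus e (body s)))).
  { intros e; split.
    - intros [Hd H]; split; [assumption|].
      destruct (classic (E (Concl Plus tDelta (compl q)))) as [Hc|Hc]; [now left | right].
      intros tau Htau; apply in_map_iff in Htau; destruct Htau as [r [<- Hr]].
      apply in_sd_rules in Hr; destruct Hr as (H1 & H2 & H3).
      destruct (H r H1 H2 H3) as [Hf|[Hf|[s (Hs & Hh & Hall & Hn)]]]; [left | easy | right].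
      + exists r; split; [now left | assumption].
      + exists s; rewrite in_attackers; do 2 (split; [auto|]); [|assumption].
        intros [t [[<-|[]] Hts]]; easy.
    - intros [Hd H]; split; [assumption|]; intros r Hr Hsd Hh.
      destruct H as [H|H]; [right; now left|].
      destruct (H [r]) as [[t [[<-|[]] Hf]]|[s (Hs & Hb & Hall)]].
      + apply singleton_team, in_sd_rules; auto.
      + now left.
      + apply in_attackers in Hs; destruct Hs as [Hs Hhs].
        right; right; exists s; do 3 (split; [assumption|]).
        intros Hrs; apply Hb; exists r; split; [now left | assumption]. }
  intros [->|[->|[->| ->]]]; [apply Team | apply Single | apply Team | apply Single].
Qed.

(** * Inclusions between the principal and the support tags *)

Definition acyclic (D : theory) : Prop :=
  forall l, ~ clos_trans label (sup D) l l.

Lemma exists_unbeaten D (l : list rule) : acyclic D -> l <> [] ->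
  exists m, In m l /\ forall x, In x l -> ~ clos_trans label (sup D) (lab x) (lab m).
Proof.
  intros Hac; apply (exists_maximal (fun x y => clos_trans label (sup D) (lab x) (lab y))).
  - intros x y z; apply t_trans.
  - intros x; apply Hac.
Qed.

Definition ambiguity_propagating (d : tag) : Prop := d = tdelta \/ d = tdeltaS.

Lemma ambiguity_propagating_principal d : ambiguity_propagating d -> principal d.
Proof. unfold principal; intros [-> | ->]; auto. Qed.

Lemma T_op_support_plus D E d q : ambiguity_propagating d ->
  T_op D E (Concl Plus (attack_tag d) q) = plusSig D E (attack_tag d) d q.
Proof. now intros [-> | ->]. Qed.

Lemma T_op_support_minus D E d q : ambiguity_propagating d ->
  T_op D E (Concl Minus (attack_tag d) q) = minusSig D E (attack_tag d) d q.
Proof. now intros [-> | ->]. Qed.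

(** Positive part: take a member [r] of the team that is maximal for superiority. An undiscarded
    attacker superior to [r] would itself be beaten by a team member, which would then lie above
    [r]. Negative part: unless a body literal of the team is refuted, every member loses to some
    proved attacker; a maximal such attacker is unbeaten, since a member beating it would lose to a
    still higher one. *)
Lemma T_iter_inclusion D d n : acyclic D -> ambiguity_propagating d -> forall q,
  (T_iter D n (Concl Plus d q) -> T_iter D n (Concl Plus (attack_tag d) q)) /\
  (T_iter D n (Concl Minus (attack_tag d) q) -> T_iter D n (Concl Minus d q)).
Proof.
  intros Hac Hd; pose proof (ambiguity_propagating_principal d Hd) as Hp.
  induction n as [|n IH]; intros q; [easy|].
  assert (IHp : forall l, allE (T_iter D n) Plus d l ->
                          allE (T_iter D n) Plus (attack_tag d) l)
    by (intros l H a Ha; apply IH, H, Ha).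
  assert (IHm : forall l, someE (T_iter D n) Minus (attack_tag d) l ->
                          someE (T_iter D n) Minus d l)
    by (intros l [a [Ha H]]; exists a; split; [assumption | now apply IH]).
  change (T_iter D (S n)) with (T_op D (T_iter D n)).
  rewrite T_op_support_plus, T_op_support_minus, T_op_plus, T_op_minus by assumption.
  split.
  - intros [H|[_ [tau (Htau & Hall & Hatt)]]]; [now left | right].
    destruct (exists_unbeaten D tau Hac (team_nonempty _ _ _ _ Htau)) as [r [Hr Hmax]].
    destruct (proj1 (in_sd_rules _ _ _) (team_sd _ _ _ _ r Htau Hr)) as (H1 & H2 & H3).
    exists r; do 3 (split; [assumption|]); split; [auto|].
    intros s Hs Hh; destruct (Hatt s) as [[t [Ht Hts]]|Hf];
      [now apply in_attackers | right | left; auto].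
    intros Hsr; apply (Hmax t Ht).
    apply t_trans with (lab s); apply t_step; assumption.
  - intros [H Hall]; split; [assumption|]; right; intros tau Htau.
    set (P := fun s => exists t, In t tau /\ supl D s t /\ allE (T_iter D n) Plus d (body s)).
    assert (HX : forall s, In s (select P (attackers (rules D) q)) <->
                           In s (attackers (rules D) q) /\ P s)
      by (intros; apply in_select).
    destruct (classic (exists t, In t tau /\ someE (T_iter D n) Minus d (body t)))
      as [Hf|Hf]; [now left | right].
    assert (Hlose : forall t, In t tau -> exists s, In s (attackers (rules D) q) /\
              allE (T_iter D n) Plus d (body s) /\ supl D s t).
    { intros t Ht.
      destruct (proj1 (in_sd_rules _ _ _) (team_sd _ _ _ _ t Htau Ht)) as (H1 & H2 & H3).
      destruct (Hall t H1 H2 H3) as [Hf'|[s (S1 & S2 & S3 & S4)]].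
      - exfalso; apply Hf; eauto.
      - exists s; rewrite in_attackers; auto. }
    destruct (exists_unbeaten D (select P (attackers (rules D) q)) Hac) as [s [Hs Hmax]].
    { destruct tau as [|t tau]; [now apply team_nonempty in Htau|].
      destruct (Hlose t (or_introl eq_refl)) as [s (S1 & S2 & S3)].
      intros Hn; assert (Hin : In s []); [|easy].
      rewrite <- Hn; apply HX; split; [assumption|]; exists t; split; [now left | auto]. }
    apply HX in Hs; destruct Hs as [Hs [t0 (Ht0 & Hst0 & Hb)]].
    exists s; split; [assumption|]; split; [|auto].
    intros [t [Ht Hts]]; destruct (Hlose t Ht) as [s' (S1 & S2 & S3)].
    apply (Hmax s'); [apply HX; split; [assumption | exists t; auto]|].
    apply t_trans with (lab t); apply t_step; assumption.
Qed.

(** * Construction of the simulating theory *)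

Definition lits (s : sign) (c : list (sign * literal)) : list literal :=
  map snd (select (fun l => fst l = s) c).

Lemma in_lits s c a : In a (lits s c) <-> In (s, a) c.
Proof.
  unfold lits; rewrite in_map_iff; split.
  - intros [[s' a'] [<- H]]; apply in_select in H; destruct H as [H <-]; exact H.
  - intros H; exists (s, a); split; [reflexivity | now apply in_select].
Qed.

Section Construction.
Variables (D : theory) (team : bool).

(** Signs are included because truth and falsity of the unrolled formulas are counted together as
    one growing chain. *)
Definition conflict_literals : list (sign * literal) :=
  list_prod [Plus; Minus] (flat_map body (rules D)).

(* Kleene formula for the [k]-th approximation of the status of [a] under the attack tag, in terms of principal statuses. The leaf [FLit a] stands for the alternative that [a] is definite; replacing it by the principal status is harmless by the inclusions between the tags. The formula serves to determine [u]; as a literal whose status depends positively or negatively on itself stays undetermined in the least fixpoint, [FLit u] encodes the truth value "undetermined". *)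
Fixpoint support (u : literal) (k : nat) (a : literal) : form :=
  match k with
  | 0 => FLit u
  | S k =>
      FOr (FLit a)
        (FEx (sd_rules (rules D) a) (fun r =>
           FAnd (FAll (body r) (support u k))
             (FAll (select (fun s => supl D s r) (attackers (rules D) a)) (fun s =>
                FEx (body s) (fun b => FNot (FLit b))))))
  end.

(** The length bounds the growth of the unrolling. Being a successor, [depth] guarantees one
    unfolding, by which a false support formula makes the principal status false and a true
    principal status makes the support formula true. *)
Definition depth : nat := S (length conflict_literals).

Definition team_form (q : literal) (tau : list rule) : form :=
  FAnd (FAll tau (fun t => FAll (body t) FLit))
    (FAll (select (fun s => ~ beats (supl D) tau s) (attackers (rules D) q)) (fun s =>
       FEx (body s) (fun a => FNot (support q depth a)))).

Definition clauses (q : literal) (tau : list rule) : list (list (sign * literal)) :=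
  dnf Plus (team_form q tau).

Definition negative_literals (q : literal) : list literal :=
  flat_map (fun tau => flat_map (lits Minus) (clauses q tau)) (teams team (rules D) q).

Lemma ev_team_form_plus V q tau :
  ev V Plus (team_form q tau) <->
  (forall t, In t tau -> forall a, In a (body t) -> V Plus a) /\
  (forall s, In s (attackers (rules D) q) -> ~ beats (supl D) tau s ->
     exists a, In a (body s) /\ ev V Minus (support q depth a)).
Proof.
  unfold team_form; change (ev V Plus (FAnd ?f ?g)) with (ev V Plus f /\ ev V Plus g).
  rewrite !ev_all_plus; split; intros [H1 H2]; split.
  - intros t Ht; exact (proj1 (ev_all_plus V _ _) (H1 t Ht)).
  - intros s Hs Hb; exact (proj1 (ev_ex_plus V _ _) (H2 s (proj2 (in_select _ _ s) (conj Hs Hb)))).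
  - intros t Ht; refine (proj2 (ev_all_plus V _ _) _); exact (H1 t Ht).
  - intros s Hs; apply in_select in Hs; destruct Hs as [Hs Hb].
    refine (proj2 (ev_ex_plus V _ _) _); exact (H2 s Hs Hb).
Qed.

Lemma ev_team_form_minus V q tau :
  ev V Minus (team_form q tau) <->
  (exists t, In t tau /\ exists a, In a (body t) /\ V Minus a) \/
  (exists s, In s (attackers (rules D) q) /\ ~ beats (supl D) tau s /\
     forall a, In a (body s) -> ev V Plus (support q depth a)).
Proof.
  unfold team_form; change (ev V Minus (FAnd ?f ?g)) with (ev V Minus f \/ ev V Minus g).
  rewrite !ev_all_minus; split; (intros [[t [Ht H]]|[s H]]; [left | right]).
  - exists t; split; [assumption | exact (proj1 (ev_all_minus V _ _) H)].
  - destruct H as [Hs H]; apply in_select in Hs; destruct Hs as [Hs Hb].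
    exists s; do 2 (split; [assumption|]); exact (proj1 (ev_ex_minus V _ _) H).
  - exists t; split; [assumption | refine (proj2 (ev_all_minus V _ _) _); exact H].
  - destruct H as (Hs & Hb & H); exists s; split; [now apply in_select|].
    refine (proj2 (ev_ex_minus V _ _) _); exact H.
Qed.

Lemma ev_support_plus V u k a :
  ev V Plus (support u (S k) a) <->
  V Plus a \/
  exists r, In r (sd_rules (rules D) a) /\
    (forall b, In b (body r) -> ev V Plus (support u k b)) /\
    (forall s, In s (attackers (rules D) a) -> supl D s r ->
       exists b, In b (body s) /\ V Minus b).
Proof.
  change (ev V Plus (support u (S k) a)) with
    (V Plus a \/ ev V Plus (FEx (sd_rules (rules D) a) (fun r =>
           FAnd (FAll (body r) (support u k))
             (FAll (select (fun s => supl D s r) (attackers (rules D) a)) (fun s =>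
                FEx (body s) (fun b => FNot (FLit b))))))).
  rewrite ev_ex_plus; split; (intros [H|[r [Hr [H1 H2]]]]; [now left | right]).
  - exists r; split; [assumption|]; split; [exact (proj1 (ev_all_plus V _ _) H1)|].
    intros s Hs Hsr.
    exact (proj1 (ev_ex_plus V _ _)
             (proj1 (ev_all_plus V _ _) H2 s (proj2 (in_select _ _ s) (conj Hs Hsr)))).
  - exists r; split; [assumption|]; split; [refine (proj2 (ev_all_plus V _ _) _); exact H1|].
    refine (proj2 (ev_all_plus V _ _) _); intros s Hs; apply in_select in Hs.
    refine (proj2 (ev_ex_plus V _ _) _); exact (H2 s (proj1 Hs) (proj2 Hs)).
Qed.

Lemma ev_support_minus V u k a :
  ev V Minus (support u (S k) a) <->
  V Minus a /\
  forall r, In r (sd_rules (rules D) a) ->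
    (exists b, In b (body r) /\ ev V Minus (support u k b)) \/
    (exists s, In s (attackers (rules D) a) /\ supl D s r /\
       forall b, In b (body s) -> V Plus b).
Proof.
  change (ev V Minus (support u (S k) a)) with
    (V Minus a /\ ev V Minus (FEx (sd_rules (rules D) a) (fun r =>
           FAnd (FAll (body r) (support u k))
             (FAll (select (fun s => supl D s r) (attackers (rules D) a)) (fun s =>
                FEx (body s) (fun b => FNot (FLit b))))))).
  rewrite ev_ex_minus; split; intros [Ha H]; (split; [assumption|]); intros r Hr;
    destruct (H r Hr) as [H'|H']; [left | right | left | right].
  - exact (proj1 (ev_all_minus V _ _) H').
  - apply (proj1 (ev_all_minus V _ _)) in H'; destruct H' as [s [Hs H']].
    apply in_select in Hs; exists s; do 2 (split; [easy|]).
    exact (proj1 (ev_ex_minus V _ _) H').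
  - refine (proj2 (ev_all_minus V _ _) _); exact H'.
  - refine (proj2 (ev_all_minus V _ _) _); destruct H' as [s (Hs & Hsr & H')].
    exists s; split; [now apply in_select | refine (proj2 (ev_ex_minus V _ _) _); exact H'].
Qed.

(* [ESupport q tau c], for a clause [c] of [team_form q tau], stands for a supporting rule for [q] that has the positive part of [c] in its body; the negative literals of [c] are tested by the defeaters [EAttack q M]. Since the latter range over all sets [M] of negative literals, the same rules work for team and for individual defeat; the empty [M] disables the strict rules as supporters. *)
Inductive entry : Type :=
  | EStrict (r : rule)
  | ESupport (q : literal) (tau : list rule) (c : list (sign * literal))
  | EAttack (q : literal) (M : list literal).

(** Listing the bodies of the team explicitly makes it immediate that one refuted team member blocks
    the whole rule. *)
Definition entry_rule (i : label) (x : entry) : rule :=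
  match x with
  | EStrict r => mkRule i (body r) (head r) Strict
  | ESupport q tau c => mkRule i (flat_map body tau ++ lits Plus c) q Defeasible
  | EAttack q M => mkRule i M (compl q) Defeater
  end.

(** Strict rules serve definite conclusions only: they override nothing, are overridden by every
    clause for the complement of their head, and have their defeasible use covered by clauses. A
    defeater for [q] that a clause for [q] does not override contains one of its negative
    literals. *)
Definition entry_sup (x y : entry) : Prop :=
  match x with
  | ESupport q tau c =>
      match y with
      | EStrict r => head r = compl q
      | ESupport q' tau' _ =>
          q' = compl q /\ forall t', In t' tau' -> beats (supl D) tau t'
      | EAttack q' M => q' = q /\ forall a, In a M -> ~ In (Minus, a) c
      end
  | _ => False
  end.

Definition entries : list entry :=
  map EStrict (select is_strict (rules D)) ++
  flat_map (fun q =>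
    flat_map (fun tau => map (ESupport q tau) (clauses q tau)) (teams team (rules D) q) ++
    map (EAttack q) (sublists (negative_literals q))) (map head (rules D)).

Definition simulation : theory :=
  mkTheory (facts D)
    (map (fun ix => entry_rule (fst ix) (snd ix)) (combine (seq 0 (length entries)) entries))
    (fun i j => exists x y, nth_error entries i = Some x /\ nth_error entries j = Some y /\
                            entry_sup x y).

Lemma in_entries x : In x entries <->
  match x with
  | EStrict r => In r (rules D) /\ is_strict r
  | ESupport q tau c => In tau (teams team (rules D) q) /\ In c (clauses q tau)
  | EAttack q M => In q (map head (rules D)) /\ In M (sublists (negative_literals q))
  end.
Proof.
  unfold entries; rewrite in_app_iff, in_map_iff, in_flat_map; split.
  - intros [[r [<- Hr]]|[q [Hq H]]]; [exact (proj1 (in_select _ _ r) Hr)|].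
    apply in_app_or in H; destruct H as [H|H].
    + apply in_flat_map in H; destruct H as [tau [Htau H]].
      apply in_map_iff in H; destruct H as [c [<- Hc]]; auto.
    + apply in_map_iff in H; destruct H as [M [<- HM]]; auto.
  - destruct x as [r|q tau c|q M].
    + intros H; left; exists r; split; [reflexivity | now apply in_select].
    + intros [Htau Hc]; right; exists q; split.
      * destruct tau as [|t tau]; [now apply team_nonempty in Htau|].
        pose proof (team_sd _ _ _ _ t Htau (or_introl eq_refl)) as Ht.
        apply in_sd_rules in Ht; apply in_map_iff; exists t; tauto.
      * apply in_or_app; left; apply in_flat_map; exists tau; split; [assumption|].
        now apply in_map.
    + intros [Hq HM]; right; exists q; split; [assumption|].
      apply in_or_app; right; now apply in_map.
Qed.

Definition encodes (r : rule) (x : entry) : Prop :=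
  nth_error entries (lab r) = Some x /\ r = entry_rule (lab r) x.

Lemma in_combine_seq {A} (l : list A) k i x :
  In (i, x) (combine (seq k (length l)) l) <-> k <= i /\ nth_error l (i - k) = Some x.
Proof.
  revert k; induction l as [|y l IH]; intros k; simpl.
  - split; [easy | intros [_ H]; now destruct (i - k)].
  - rewrite IH; split.
    + intros [H|[Hk H]].
      * injection H as <- <-; rewrite Nat.sub_diag; auto.
      * split; [lia|]; now replace (i - k) with (S (i - S k)) by lia.
    + intros [Hk H]; destruct (Nat.eq_dec k i) as [->|Hn].
      * rewrite Nat.sub_diag in H; injection H as ->; now left.
      * right; split; [lia|]; now replace (i - k) with (S (i - S k)) in H by lia.
Qed.

Lemma entry_rule_lab i x : lab (entry_rule i x) = i.
Proof. now destruct x. Qed.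

Lemma in_simulation r : In r (rules simulation) <-> exists x, encodes r x.
Proof.
  simpl; rewrite in_map_iff; unfold encodes; split.
  - intros [[i x] [<- H]]; apply in_combine_seq in H; destruct H as [_ H].
    rewrite Nat.sub_0_r in H; exists x; simpl; now rewrite entry_rule_lab.
  - intros [x [Hx Hr]]; exists (lab r, x); split; [now symmetry|].
    apply in_combine_seq; rewrite Nat.sub_0_r; split; [lia | assumption].
Qed.

Lemma encodes_in_entries r x : encodes r x -> In x entries.
Proof. intros [H _]; now apply nth_error_In in H. Qed.

Lemma entry_encoded x : In x entries -> exists r, In r (rules simulation) /\ encodes r x.
Proof.
  intros H; apply In_nth_error in H; destruct H as [i Hi].
  assert (He : encodes (entry_rule i x) x) by (unfold encodes; now rewrite entry_rule_lab).
  exists (entry_rule i x); split; [apply in_simulation; eauto | assumption].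
Qed.

Lemma simulation_sup r s x y : encodes r x -> encodes s y ->
  supl simulation r s <-> entry_sup x y.
Proof.
  unfold supl; simpl; intros [Hx _] [Hy _]; split.
  - intros [x' [y' (Hx' & Hy' & H)]]; rewrite Hx in Hx'; rewrite Hy in Hy'.
    injection Hx' as ->; injection Hy' as ->; exact H.
  - eauto 6.
Qed.

Lemma simulation_wf : acyclic D -> wf_theory simulation.
Proof.
  intros Hac; split.
  - replace (map lab (rules simulation)) with (seq 0 (length entries)); [apply seq_NoDup|].
    simpl; rewrite map_map.
    rewrite (map_ext _ fst) by (intros [i x]; apply entry_rule_lab).
    generalize 0; induction entries as [|x l IH]; simpl; [easy|]; intros k; now rewrite <- IH.
  - (* A cycle would pass through teams each of which beats the next one. *)
    assert (H : forall i j, clos_trans label (sup simulation) i j ->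
      exists q tau c, nth_error entries i = Some (ESupport q tau c) /\
        forall q' tau' c', nth_error entries j = Some (ESupport q' tau' c') ->
          forall t', In t' tau' -> exists t, In t tau /\
            clos_trans label (sup D) (lab t) (lab t')).
    { intros i j; induction 1 as [i j [x [y (Hx & Hy & H)]]|i j k _ IH1 _ IH2].
      - destruct x as [|q tau c|]; [easy| |easy].
        exists q, tau, c; split; [assumption|]; intros q' tau' c' Hj t' Ht'.
        rewrite Hj in Hy; injection Hy as <-; destruct H as [_ H].
        destruct (H t' Ht') as [t [Ht Htt]]; exists t; split; [assumption | now apply t_step].
      - destruct IH1 as (q1 & tau1 & c1 & Hi & H1), IH2 as (q2 & tau2 & c2 & Hj & H2).
        exists q1, tau1, c1; split; [assumption|]; intros q' tau' c' Hk t' Ht'.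
        destruct (H2 _ _ _ Hk t' Ht') as [t2 [Ht2 H2']].
        destruct (H1 _ _ _ Hj t2 Ht2) as [t1 [Ht1 H1']].
        exists t1; split; [assumption | now apply t_trans with (lab t2)]. }
    intros l Hl; destruct (H l l Hl) as (q & tau & c & Hi & Hb).
    specialize (Hb _ _ _ Hi).
    assert (Htau : In tau (teams team (rules D) q))
      by (apply nth_error_In in Hi; now apply in_entries in Hi).
    destruct (exists_unbeaten D tau Hac (team_nonempty _ _ _ _ Htau)) as [m [Hm Hmax]].
    destruct (Hb m Hm) as [t [Ht Htm]]; exact (Hmax t Ht Htm).
Qed.

Lemma simulation_sd r x q : encodes r x -> In r (sd_rules (rules simulation) q) ->
  match x with
  | EStrict r0 => head r0 = q
  | ESupport q' tau c => q' = q
  | EAttack _ _ => False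
  end.
Proof.
  intros [_ ->] H; apply in_sd_rules in H; destruct H as (_ & H & Hh).
  destruct x; simpl in *; try assumption; destruct H; discriminate.
Qed.

Lemma simulation_head r q : In r (sd_rules (rules simulation) q) ->
  In q (map head (rules D)).
Proof.
  intros H; pose proof H as Hr; apply in_sd_rules in Hr; destruct Hr as [Hr _].
  apply in_simulation in Hr; destruct Hr as [x Hx].
  apply (simulation_sd r x q Hx) in H; apply encodes_in_entries, in_entries in Hx.
  destruct x as [r0|q' tau c|]; [| |easy]; subst.
  - now apply in_map.
  - destruct Hx as [Htau _]; destruct tau as [|t tau]; [now apply team_nonempty in Htau|].
    pose proof (team_sd _ _ _ _ t Htau (or_introl eq_refl)) as Ht.
    apply in_sd_rules in Ht; apply in_map_iff; exists t; tauto.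
Qed.

Lemma simulation_attackers s q : In s (attackers (rules simulation) q) ->
  exists y, encodes s y /\
    match y with
    | EStrict r => head r = compl q
    | ESupport q' tau _ =>
        q' = compl q /\ forall t, In t tau -> In t (attackers (rules D) q)
    | EAttack q' _ => q' = q
    end.
Proof.
  intros H; apply in_attackers in H; destruct H as [Hs Hh].
  apply in_simulation in Hs; destruct Hs as [y Hy]; exists y; split; [assumption|].
  pose proof (encodes_in_entries _ _ Hy) as Hin; apply in_entries in Hin.
  destruct Hy as [_ Hy]; rewrite Hy in Hh; destruct y as [r|q' tau c|q' M]; simpl in Hh.
  - assumption.
  - split; [assumption|]; intros t Ht; rewrite in_attackers, <- Hh.
    pose proof (team_sd _ _ _ _ t (proj1 Hin) Ht) as H; apply in_sd_rules in H; tauto.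
  - now rewrite <- (compl_compl q'), Hh, compl_compl.
Qed.

Lemma in_negative_literals q tau c a :
  In tau (teams team (rules D) q) -> In c (clauses q tau) -> In (Minus, a) c ->
  In a (negative_literals q).
Proof.
  intros Htau Hc Ha; apply in_flat_map; exists tau; split; [assumption|].
  apply in_flat_map; exists c; split; [assumption | now apply in_lits].
Qed.

Lemma attack_encoded P q : In q (map head (rules D)) ->
  exists s, In s (attackers (rules simulation) q) /\
            encodes s (EAttack q (select P (negative_literals q))).
Proof.
  intros Hq.
  destruct (entry_encoded (EAttack q (select P (negative_literals q)))) as [s [Hs He]].
  - apply in_entries; split; [assumption | apply filter_sublist].
  - exists s; split; [|assumption]; apply in_attackers; split; [assumption|].
    destruct He as [_ ->]; reflexivity.
Qed.

Lemma support_encoded q tau c : In tau (teams team (rules D) q) -> In c (clauses q tau) ->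
  exists r, In r (sd_rules (rules simulation) q) /\ encodes r (ESupport q tau c).
Proof.
  intros Htau Hc; destruct (entry_encoded (ESupport q tau c)) as [r [Hr He]].
  - now apply in_entries.
  - exists r; split; [|assumption]; apply in_sd_rules; split; [assumption|].
    destruct He as [_ ->]; split; [now right | reflexivity].
Qed.

(** Only clause rules are superior to anything, so whatever beats a defeater is a clause whose
    negative literals avoid [M]. *)
Lemma beats_attack T s q M : (forall t, In t T -> In t (sd_rules (rules simulation) q)) ->
  encodes s (EAttack q M) -> beats (supl simulation) T s ->
  exists t tau c, In t T /\ In tau (teams team (rules D) q) /\ In c (clauses q tau) /\
    body t = flat_map body tau ++ lits Plus c /\ forall a, In a M -> ~ In (Minus, a) c.
Proof.
  intros HT Hs [t [Ht Hts]].
  pose proof (HT t Ht) as Hsd; apply in_sd_rules in Hsd; destruct Hsd as [Htr _].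
  apply in_simulation in Htr; destruct Htr as [x Hx].
  rewrite (simulation_sup _ _ _ _ Hx Hs) in Hts.
  destruct x as [|q' tau c|]; [easy| |easy]; destruct Hts as [<- HM].
  pose proof (encodes_in_entries _ _ Hx) as Hin; apply in_entries in Hin.
  exists t, tau, c; split; [assumption|]; do 2 (split; [easy|]); split; [|assumption].
  destruct Hx as [_ ->]; reflexivity.
Qed.

(** * One step of ambiguity blocking evaluates the team formulas *)

(** A satisfied clause gives a rule that overcomes all attackers alone, so singletons suffice and
    the kind of defeat [team2] makes no difference. Conversely, a suitably chosen defeater forces
    some clause in [T] to be satisfied. *)
Lemma simulation_supported V team2 q :
  (exists T, In T (teams team2 (rules simulation) q) /\
     (forall t, In t T -> forall a, In a (body t) -> V Plus a) /\
     (forall s, In s (attackers (rules simulation) q) ->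
        beats (supl simulation) T s \/ exists a, In a (body s) /\ V Minus a)) <->
  (exists tau, In tau (teams team (rules D) q) /\ ev V Plus (team_form q tau)).
Proof.
  split.
  - intros [T (HT & Hall & Hatt)].
    assert (Hq : In q (map head (rules D))).
    { destruct T as [|r T]; [now apply team_nonempty in HT|].
      apply (simulation_head r), (team_sd _ _ _ _ _ HT); now left. }
    (* This defeater tests exactly the negative literals that are not false. No literal of its body
       is refuted, so it must be overridden, and the overriding clause has only false negative
       literals. *)
    destruct (attack_encoded (fun a => ~ V Minus a) q Hq) as [s [Hs He]].
    destruct (Hatt s Hs) as [Hb|[a [Ha Hf]]].
    + destruct (beats_attack T s q _ (fun t => team_sd _ _ _ _ t HT) He Hb)
        as (t & tau & c & Ht & Htau & Hc & Hbt & HM).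
      exists tau; split; [assumption|]; apply dnf_true; exists c; split; [assumption|].
      intros [] a Ha.
      * apply (Hall t Ht); rewrite Hbt, in_app_iff, in_lits; now right.
      * apply NNPP; intros Hn; apply (HM a); [|assumption].
        apply in_select; split; [eapply in_negative_literals; eauto | assumption].
    + destruct He as [_ He]; rewrite He in Ha; now apply in_select in Ha.
  - intros [tau [Htau Hev]].
    destruct (proj1 (dnf_true _ _ _) Hev) as [c [Hc Hsat]].
    apply ev_team_form_plus in Hev; destruct Hev as [Hpos Hatt].
    destruct (support_encoded q tau c Htau Hc) as [r [Hr He]].
    exists [r]; split; [now apply singleton_team|]; split.
    + intros t [<-|[]] a Ha; destruct He as [_ He]; rewrite He in Ha; simpl in Ha.
      rewrite in_app_iff, in_flat_map, in_lits in Ha; destruct Ha as [[t [Ht Ha]]|Ha]; eauto.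
    + intros s Hs; destruct (simulation_attackers s q Hs) as [y [Hy Hcase]].
      assert (Hbeat : entry_sup (ESupport q tau c) y -> beats (supl simulation) [r] s)
        by (intros H; exists r; split; [now left | now apply (simulation_sup _ _ _ _ He Hy)]).
      destruct y as [r0|q' tau' c'|q' M].
      * left; now apply Hbeat.
      (* If [tau] does not beat all of the opposing team, some member [t'] attacks in the original
         theory unbeaten. The truth of the team formula then makes a support formula for a body
         literal of [t'] false, hence also the principal status of that literal, which occurs in the
         body of [s]. *)
      * destruct Hcase as [-> Htau'].
        destruct (classic (forall t', In t' tau' -> beats (supl D) tau t')) as [H|H];
          [left; now apply Hbeat | right].
        apply not_all_ex_not in H; destruct H as [t' H].
        apply imply_to_and in H; destruct H as [Ht' Hb].
        destruct (Hatt t' (Htau' t' Ht') Hb) as [a [Ha Hf]].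
        exists a; split; [|now apply ev_support_minus in Hf].
        destruct Hy as [_ ->]; apply in_or_app; left; apply in_flat_map; eauto.
      * subst q'; destruct (classic (exists a, In a M /\ In (Minus, a) c)) as [[a [Ha Hm]]|H].
        -- right; exists a; split; [destruct Hy as [_ ->]; exact Ha | now apply Hsat].
        -- left; apply Hbeat; split; [reflexivity|]; intros a Ha Hm; apply H; eauto.
Qed.

(** A successful attack on a clause rule by a defeater exhibits a true negative literal of the
    clause. One by a clause for the complement exhibits an unbeaten attacker with true body, and
    principal truth implies truth of the support formulas, so the whole team formula is false. *)
Lemma simulation_refuted V team2 q :
  (forall T, In T (teams team2 (rules simulation) q) ->
     (exists t, In t T /\ exists a, In a (body t) /\ V Minus a) \/
     (exists s, In s (attackers (rules simulation) q) /\ ~ beats (supl simulation) T s /\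
        forall a, In a (body s) -> V Plus a)) <->
  (forall tau, In tau (teams team (rules D) q) -> ev V Minus (team_form q tau)).
Proof.
  split.
  - intros H tau Htau; apply (dnf_false V _ Plus); intros c Hc.
    assert (Href : ev V Minus (team_form q tau) ->
              exists s' a, In (s', a) c /\ V (opp s') a)
      by (intros Hev; exact (proj1 (dnf_false V _ Plus) Hev c Hc)).
    destruct (support_encoded q tau c Htau Hc) as [r [Hr He]].
    destruct (H [r] (singleton_team _ _ _ _ Hr))
      as [[t [[<-|[]] [a [Ha Hf]]]]|[s (Hs & Hb & Hall)]].
    + destruct He as [_ He]; rewrite He in Ha; simpl in Ha.
      rewrite in_app_iff, in_flat_map, in_lits in Ha; destruct Ha as [[t [Ht Ha]]|Ha].
      * apply Href, ev_team_form_minus; left; eauto.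
      * exists Plus, a; auto.
    + destruct (simulation_attackers s q Hs) as [y [Hy Hcase]].
      assert (Hbeat : ~ entry_sup (ESupport q tau c) y).
      { intros H'; apply Hb; exists r; split; [now left|].
        now apply (simulation_sup _ _ _ _ He Hy). }
      destruct y as [r0|q' tau' c'|q' M]; [easy| |].
      * destruct Hcase as [-> Htau'].
        apply Href, ev_team_form_minus; right; apply NNPP; intros Hn; apply Hbeat.
        split; [reflexivity|]; intros t' Ht'; apply NNPP; intros Hb'.
        apply Hn; exists t'; do 2 (split; [auto|]); intros a Ha.
        apply ev_support_plus; left; apply Hall; destruct Hy as [_ ->].
        apply in_or_app; left; apply in_flat_map; eauto.
      * subst q'; apply NNPP; intros Hn; apply Hbeat; split; [reflexivity|].
        intros a Ha Hm; apply Hn; exists Minus, a; split; [assumption|].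
        apply Hall; destruct Hy as [_ ->]; exact Ha.
  - intros H T HT.
    assert (Hq : In q (map head (rules D))).
    { destruct T as [|r T]; [now apply team_nonempty in HT|].
      apply (simulation_head r), (team_sd _ _ _ _ _ HT); now left. }
    destruct (classic (exists t, In t T /\ exists a, In a (body t) /\ V Minus a))
      as [Hf|Hf]; [now left | right].
    (* The defeater over all true negative literals is applicable. A clause overriding it has no
       true negative literal, so being false it has a false positive one, which would refute the
       body of a rule in [T]. *)
    destruct (attack_encoded (V Plus) q Hq) as [s [Hs He]].
    exists s; split; [assumption|]; split.
    + intros Hb.
      destruct (beats_attack T s q _ (fun t => team_sd _ _ _ _ t HT) He Hb)
        as (t & tau & c & Ht & Htau & Hc & Hbt & HM).
      destruct (proj1 (dnf_false V _ Plus) (H tau Htau) c Hc) as [[] [a [Ha Hv]]].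
      * apply Hf; exists t; split; [assumption|]; exists a; split; [|assumption].
        rewrite Hbt, in_app_iff, in_lits; now right.
      * apply (HM a); [|assumption]; apply in_select; split; [|assumption].
        eapply in_negative_literals; eauto.
    + intros a Ha; destruct He as [_ He]; rewrite He in Ha; now apply in_select in Ha.
Qed.

End Construction.

(** * Stabilization of the unrolled support formulas *)

(** Depth 0 is undetermined, so the first unfolding can only decide more, and each further unfolding
    preserves this. *)
Lemma support_mono D V u k s a : (forall s', ~ V s' u) ->
  ev V s (support D u k a) -> ev V s (support D u (S k) a).
Proof.
  intros Hu; revert s a; induction k as [|k IH]; intros s a H; [now apply Hu in H|].
  destruct s.
  - apply ev_support_plus; apply ev_support_plus in H.
    destruct H as [H|[r (Hr & H1 & H2)]]; [now left | right].
    exists r; split; [assumption|]; split; [auto | assumption].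
  - apply ev_support_minus; apply ev_support_minus in H; destruct H as [Ha H].
    split; [assumption|]; intros r Hr.
    destruct (H r Hr) as [[b [Hb H']]|H']; [left; eauto | now right].
Qed.

Lemma in_conflict_literals D s r a : In r (rules D) -> In a (body r) ->
  In (s, a) (conflict_literals D).
Proof.
  intros Hr Ha; apply in_prod; [destruct s; simpl; auto | apply in_flat_map; eauto].
Qed.

(** An unfolding reads the previous depth at body literals only, so a depth that adds nothing on
    [conflict_literals] is followed by another that adds nothing. *)
Lemma support_stable D V u s a : (forall s', ~ V s' u) ->
  In (s, a) (conflict_literals D) ->
  ev V s (support D u (S (depth D)) a) -> ev V s (support D u (depth D) a).
Proof.
  intros Hu Ha.
  apply (chain_stabilizes (fun k x => ev V (fst x) (support D u k (snd x)))
           (conflict_literals D)) with (x := (s, a)).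
  - intros k x _; now apply support_mono.
  - intros k Hst [[] b] _ H; simpl in *.
    + apply (ev_support_plus D V u (S k)) in H; apply (ev_support_plus D V u k).
      destruct H as [H|[r (Hr & H1 & H2)]]; [now left | right].
      exists r; split; [assumption|]; split; [|assumption]; intros c Hc.
      apply in_sd_rules in Hr.
      apply (Hst (Plus, c)); [now apply (in_conflict_literals D _ r) | now apply H1].
    + apply (ev_support_minus D V u (S k)) in H; apply (ev_support_minus D V u k).
      destruct H as [Hb H]; split; [assumption|]; intros r Hr.
      destruct (H r Hr) as [[c [Hc H']]|H']; [left | now right].
      exists c; split; [assumption|]; apply in_sd_rules in Hr.
      apply (Hst (Minus, c)); [now apply (in_conflict_literals D _ r) | assumption].
  - unfold depth; lia.
  - assumption.
Qed.

(** * Soundness and completeness of the simulation *)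

Section Correctness.
Variables (D : theory) (d1 d2 : tag).
Hypothesis Hac : acyclic D.
Hypothesis Hd1 : ambiguity_propagating d1.
Hypothesis Hd2 : d2 = tPartial \/ d2 = tPartialS.

Let D' := simulation D (team_defeat d1).
Let value (E : concl -> Prop) (d : tag) (s : sign) (a : literal) : Prop := E (Concl s d a).

Lemma simulation_strict r : In r (rules D') -> is_strict r ->
  exists r0, In r0 (rules D) /\ is_strict r0 /\ head r0 = head r /\ body r0 = body r.
Proof.
  intros Hr Hs; apply in_simulation in Hr; destruct Hr as [x Hx].
  pose proof (encodes_in_entries _ _ _ _ Hx) as Hin; apply in_entries in Hin.
  destruct Hx as [_ Hx]; rewrite Hx in Hs |- *.
  destruct x as [r0| |]; [|discriminate..]; exists r0; simpl; tauto.
Qed.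

Lemma strict_simulated r : In r (rules D) -> is_strict r ->
  exists r', In r' (rules D') /\ is_strict r' /\ head r' = head r /\ body r' = body r.
Proof.
  intros Hr Hs.
  destruct (entry_encoded D (team_defeat d1) (EStrict r)) as [r' [Hr' [_ He]]].
  - now apply in_entries.
  - exists r'; split; [assumption|]; rewrite He; simpl; repeat split.
Qed.

Lemma T_iter_definite n s q :
  T_iter D n (Concl s tDelta q) <-> T_iter D' n (Concl s tDelta q).
Proof.
  revert s q; induction n as [|n IH]; intros s q; [easy|].
  destruct s; simpl; unfold plusDelta, minusDelta, allE, someE; simpl.
  - split; (intros [H|[r (Hr & Hs & Hh & H)]]; [now left | right]).
    + destruct (strict_simulated r Hr Hs) as (r' & H1 & H2 & H3 & H4).
      exists r'; rewrite H3, H4; do 3 (split; [assumption|]); intros a Ha; apply IH; auto.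
    + destruct (simulation_strict r Hr Hs) as (r' & H1 & H2 & H3 & H4).
      exists r'; rewrite H3, H4; do 3 (split; [assumption|]); intros a Ha; apply IH; auto.
  - split; intros [Hf H]; (split; [assumption|]); intros r Hr Hs Hh.
    + destruct (simulation_strict r Hr Hs) as (r' & H1 & H2 & H3 & H4).
      destruct (H r' H1 H2) as [a [Ha H']]; [congruence|].
      exists a; rewrite <- H4; split; [assumption | now apply IH].
    + destruct (strict_simulated r Hr Hs) as (r' & H1 & H2 & H3 & H4).
      destruct (H r' H1 H2) as [a [Ha H']]; [congruence|].
      exists a; rewrite <- H4; split; [assumption | now apply IH].
Qed.

Lemma derives_definite s q :
  derives D (Concl s tDelta q) <-> derives D' (Concl s tDelta q).
Proof. split; intros [n Hn]; exists n; now apply T_iter_definite. Qed.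

Lemma T_op_simulation_plus E q :
  T_op D' E (Concl Plus d2 q) <->
  E (Concl Plus tDelta q) \/
  (E (Concl Minus tDelta (compl q)) /\
   exists tau, In tau (teams (team_defeat d1) (rules D) q) /\
     ev (value E d2) Plus (team_form D q tau)).
Proof.
  assert (Hp : principal d2) by (unfold principal; tauto).
  rewrite T_op_plus by assumption.
  replace (attack_tag d2) with d2 by (destruct Hd2 as [-> | ->]; reflexivity).
  rewrite <- (simulation_supported D (team_defeat d1) (value E d2) (team_defeat d2) q).
  reflexivity.
Qed.

Lemma T_op_simulation_minus E q :
  T_op D' E (Concl Minus d2 q) <->
  E (Concl Minus tDelta q) /\
  (E (Concl Plus tDelta (compl q)) \/
   forall tau, In tau (teams (team_defeat d1) (rules D) q) ->
     ev (value E d2) Minus (team_form D q tau)).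
Proof.
  assert (Hp : principal d2) by (unfold principal; tauto).
  rewrite T_op_minus by assumption.
  replace (attack_tag d2) with d2 by (destruct Hd2 as [-> | ->]; reflexivity).
  rewrite <- (simulation_refuted D (team_defeat d1) (value E d2) (team_defeat d2) q).
  reflexivity.
Qed.

(** Here the leaf put in place of definite provability is seen to be harmless: [+d1] gives the
    positive support conclusion by inclusion, and [-d1] has the negative definite conclusion among
    its premises. *)
Lemma derives_support s a V u k :
  (forall s a, V s a -> derives D (Concl s d1 a)) -> (forall s, ~ V s u) ->
  ev V s (support D u k a) -> derives D (Concl s (attack_tag d1) a).
Proof.
  intros HV Hu; revert s a; induction k as [|k IH]; intros s a H; [now apply Hu in H|].
  destruct s.
  - apply ev_support_plus in H; destruct H as [H|[r (Hr & H1 & H2)]].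
    + destruct (HV Plus a H) as [n Hn]; exists n; now apply T_iter_inclusion.
    + apply derives_closed; rewrite T_op_support_plus by assumption.
      apply in_sd_rules in Hr; destruct Hr as (Hr & Hsd & Hh).
      right; exists r; do 3 (split; [assumption|]); split; [intros b Hb; auto|].
      intros s Hs Hhs; destruct (classic (supl D s r)) as [Hsr|Hsr]; [left | now right].
      destruct (H2 s) as [b [Hb H']]; [now apply in_attackers | assumption|].
      exists b; auto.
  - apply ev_support_minus in H; destruct H as [Ha H].
    apply derives_closed; rewrite T_op_support_minus by assumption; split.
    + pose proof (derives_open _ _ (HV Minus a Ha)) as Hd.
      apply T_op_minus in Hd; [easy | now apply ambiguity_propagating_principal].
    + intros r Hr Hsd Hh.
      destruct (H r) as [[b [Hb H']]|[s (Hs & Hsr & H')]]; [now apply in_sd_rules | left | right].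
      * exists b; auto.
      * apply in_attackers in Hs; exists s; do 2 (split; [easy|]); split; [|assumption].
        intros b Hb; auto.
Qed.

(** Induction on the stages of the simulating theory. Only a newly decided [q] needs work; by
    coherence it was undecided with either sign one stage before, so it may serve as the
    undetermined leaf of its own formulas. *)
Lemma simulation_sound n s q :
  T_iter D' n (Concl s d2 q) -> derives D (Concl s d1 q).
Proof.
  revert s q; induction n as [|n IH]; intros s q H; [easy|].
  destruct (classic (T_iter D' n (Concl s d2 q))) as [Hn|Hn]; [now apply IH|].
  assert (Hu : forall s', ~ T_iter D' n (Concl s' d2 q)).
  { intros s' Hs'.
    assert (Hs'' : T_iter D' (S n) (Concl s' d2 q))
      by (apply (T_iter_mono D' n); [lia | assumption]).
    destruct s, s'; try easy; eapply T_iter_coherent; eassumption. }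
  assert (Hsup : forall s' a, ev (value (T_iter D' n) d2) s' (support D q (depth D) a) ->
                   derives D (Concl s' (attack_tag d1) a)).
  { intros s' a; apply derives_support; [exact IH | exact Hu]. }
  assert (Hdef : forall s' a, T_iter D' n (Concl s' tDelta a) -> derives D (Concl s' tDelta a))
    by (intros s' a Ha; apply derives_definite; now exists n).
  pose proof (ambiguity_propagating_principal d1 Hd1) as Hp.
  change (T_op D' (T_iter D' n) (Concl s d2 q)) in H.
  apply derives_closed; destruct s.
  - apply T_op_simulation_plus in H; apply T_op_plus; [assumption|].
    destruct H as [H|[Hd [tau [Htau H]]]]; [left; auto | right; split; [auto|]].
    apply ev_team_form_plus in H; destruct H as [Hall Hatt].
    exists tau; split; [assumption|]; split.
    + intros t Ht a Ha; apply IH, (Hall t Ht a Ha).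
    + intros s Hs; destruct (classic (beats (supl D) tau s)) as [Hb|Hb]; [now left | right].
      destruct (Hatt s Hs Hb) as [a [Ha H']]; exists a; auto.
  - apply T_op_simulation_minus in H; apply T_op_minus; [assumption|].
    destruct H as [Hd H]; split; [auto|]; destruct H as [H|H]; [left; auto | right].
    intros tau Htau; specialize (H tau Htau); apply ev_team_form_minus in H.
    destruct H as [[t [Ht [a [Ha H]]]]|[s (Hs & Hb & H)]]; [left | right].
    + exists t; split; [assumption|]; exists a; split; [assumption | now apply IH].
    + exists s; do 2 (split; [assumption|]); intros a Ha; auto.
Qed.

(** Both parts climb the stages of [D] together, because principal conclusions judge attackers by
    the support tag, and support conclusions judge them by the principal tag. *)
Lemma simulation_complete n :
  (forall s q, T_iter D n (Concl s d1 q) -> derives D' (Concl s d2 q)) /\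
  (forall s a u, In (s, a) (conflict_literals D) ->
     (forall s', ~ derives D' (Concl s' d2 u)) ->
     T_iter D n (Concl s (attack_tag d1) a) ->
     ev (value (derives D') d2) s (support D u (depth D) a)).
Proof.
  pose proof (ambiguity_propagating_principal d1 Hd1) as Hp.
  induction n as [|n [IHd IHs]]; [easy|].
  assert (Hdef : forall s' a, T_iter D n (Concl s' tDelta a) -> derives D' (Concl s' tDelta a))
    by (intros s' a Ha; apply derives_definite; now exists n).
  assert (Hprin : forall s q, T_iter D (S n) (Concl s d1 q) -> derives D' (Concl s d2 q)).
  { intros s q H.
    destruct (classic (derives D' (Concl s d2 q))) as [Hn|Hn]; [assumption|].
    (* Soundness carries a conclusion of the opposite sign back to [D], where it contradicts
       coherence. Hence [q] is undetermined and usable as the leaf. *)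
    assert (Hu : forall s', ~ derives D' (Concl s' d2 q)).
    { intros s' Hs'; assert (Hs'' : derives D (Concl s' d1 q))
        by (destruct Hs' as [m Hm]; exact (simulation_sound m s' q Hm)).
      assert (H' : derives D (Concl s d1 q)) by now exists (S n).
      destruct s, s'; try easy; eapply derives_coherent; eassumption. }
    change (T_op D (T_iter D n) (Concl s d1 q)) in H.
    apply derives_closed; destruct s.
    - apply T_op_simulation_plus; apply T_op_plus in H; [|assumption].
      destruct H as [H|[Hd [tau (Htau & Hall & Hatt)]]]; [left; auto | right; split; [auto|]].
      exists tau; split; [assumption|]; apply ev_team_form_plus; split.
      + intros t Ht a Ha; apply IHd, (Hall t Ht a Ha).
      + intros s Hs Hb; destruct (Hatt s Hs) as [|[a [Ha H']]]; [easy|].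
        apply in_attackers in Hs; exists a; split; [assumption|]; apply IHs; auto.
        now apply (in_conflict_literals D _ s).
    - apply T_op_simulation_minus; apply T_op_minus in H; [|assumption].
      destruct H as [Hd H]; split; [auto|]; destruct H as [H|H]; [left; auto | right].
      intros tau Htau; apply ev_team_form_minus.
      destruct (H tau Htau) as [[t [Ht [a [Ha H']]]]|[s (Hs & Hb & H')]]; [left | right].
      + exists t; split; [assumption|]; exists a; split; [assumption | now apply IHd].
      + exists s; do 2 (split; [assumption|]); intros a Ha; apply in_attackers in Hs.
        apply IHs; auto; now apply (in_conflict_literals D _ s). }
  split; [exact Hprin|]; intros s a u Ha Hu H.
  (* The induction hypothesis speaks of [depth], and unfolding once more lands one level higher;
     stabilization absorbs the difference. *)
  apply support_stable; [exact Hu | assumption|].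
  pose proof H as H0; change (T_op D (T_iter D n) (Concl s (attack_tag d1) a)) in H.
  destruct s.
  - rewrite T_op_support_plus in H by assumption; apply ev_support_plus.
    destruct H as [H|[r (Hr & Hsd & Hh & H & Hatt)]]; [left | right].
    + apply derives_closed, T_op_simulation_plus; left; auto.
    + exists r; split; [now apply in_sd_rules|]; split.
      * intros b Hb; apply IHs; auto; now apply (in_conflict_literals D _ r).
      * intros s Hs Hsr; apply in_attackers in Hs.
        destruct (Hatt s) as [[b [Hb H']]|]; [easy..| |easy].
        exists b; split; [assumption | now apply IHd].
  (* The inclusion gives a principal refutation at the same stage [S n], which is why [Hprin] was
     proved for that stage beforehand. *)
  - apply ev_support_minus; split; [apply Hprin; now apply T_iter_inclusion|].
    rewrite T_op_support_minus in H by assumption; destruct H as [_ H].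
    intros r Hr; apply in_sd_rules in Hr; destruct Hr as (Hr & Hsd & Hh).
    destruct (H r Hr Hsd Hh) as [[b [Hb H']]|[s (Hs & Hhs & Hb & Hsr)]]; [left | right].
    + exists b; split; [assumption|]; apply IHs; auto.
      now apply (in_conflict_literals D _ r).
    + exists s; split; [now apply in_attackers|]; split; [assumption|].
      intros b Hin; apply IHd, Hb, Hin.
Qed.

Lemma derives_simulation s q :
  derives D (Concl s d1 q) <-> derives D' (Concl s d2 q).
Proof.
  split; intros [n Hn].
  - now apply (simulation_complete n).
  - now apply (simulation_sound n).
Qed.

End Correctness.

(** * Addition of facts *)

Definition with_facts (D : theory) (F : literal -> Prop) : theory :=
  mkTheory F (rules D) (sup D).

Lemma add_facts D F :
  add_theory D (facts_theory F) = with_facts D (fun q => facts D q \/ F q).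
Proof.
  unfold add_theory, with_facts; simpl; rewrite app_nil_r; f_equal.
  extensionality l; extensionality l'; apply propositional_extensionality; tauto.
Qed.

Theorem theorem5 :
  forall d1 d2 : tag,
    (d1 = tdelta \/ d1 = tdeltaS) ->
    (d2 = tPartial \/ d2 = tPartialS) ->
    forall D1 : theory, wf_theory D1 ->
      exists D2 : theory, wf_theory D2 /\ simulated_facts d1 D1 d2 D2.
Proof.
  intros d1 d2 Hd1 Hd2 D [_ Hac].
  exists (simulation D (team_defeat d1)); split; [now apply simulation_wf|].
  intros F A _ q _; unfold A; rewrite !add_facts.
  set (F' := fun q => facts D q \/ F q).
  (* The rules and priorities of the simulation depend only on the rules and priorities of [D], so
     the construction commutes with changing the facts by mere conversion. *)
  change (with_facts (simulation D (team_defeat d1)) _)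
    with (simulation (with_facts D F') (team_defeat d1)).
  split; now apply derives_simulation.
Qed.
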